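(* Define a product $(X,Y)\mapsto XY$ on $W$ by $e_H\,e_J=\sigma(H,J)\,e_{H\triangle J}$ for $H,J\in\mathcal{F}$, extended $R$-bilinearly to $W$. Then $W$ becomes an algebra (associative, with unit) having $e_\emptyset$ as unit, and such that (i) for all $i,j\in M$ with $i\neq j$: $e_ie_j=-e_je_i$; and (ii) for all $x\in V$: $x^2=B(x,x)\,e_\emptyset$.
   Context: Setting: $R$ is a commutative ring with unit $1\neq 0$; $V\neq\{0\}$ is a free unitary $R$-module with basis $(e_i\mid i\in M)$, where the index set $M$ (possibly infinite) is totally ordered by $<$; $B:V\times V\to R$ is a bilinear form which is diagonal in this basis, i.e. $B(e_i,e_j)=0$ for $i\ne j$; and $q(i)=B(e_i,e_i)$. $\mathcal{F}$ is the set of finite subsets of $M$, and $W=\bigoplus_{\mathcal{F}}R$ is the free $R$-module with basis $(e_K\mid K\in\mathcal{F})$. $V$ is regarded as a submodule of $W$ by identifying $e_i$ with $e_{\{i\}}$. $H\triangle J=(H\cup J)\setminus(H\cap J)$ is the symmetric difference. For $H,J\in\mathcal{F}$: $\alpha(H,J)=\prod(-1)$, the product taken over all pairs $(i,j)\in H\times J$ with $j<i$; $\beta(H,J)=\prod_{i\in H\cap J}q(i)$; and $\sigma(H,J)=\alpha(H,J)\,\beta(H,J)$. Empty products equal $1$. An algebra is an $R$-module equipped with an $R$-bilinear associative composition having a unit. *)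

(* Defs.v *)
From HB Require Import structures.
From mathcomp Require Import all_boot all_order all_algebra.
From mathcomp Require Export finmap.
From mathcomp Require Export monalg.

Set Implicit Arguments.
Unset Strict Implicit.
Unset Printing Implicit Defensive.

Import Order.TTheory GRing.Theory.

Local Open Scope fset_scope.
Local Open Scope ring_scope.

Section LinearCombinations.
Context {R : comNzRingType} {V : lmodType R} {I : choiceType}.
Implicit Types (e : I -> V) (c : {malg R[I]}) (v : V).

(* [{malg R[I]}] is the module of finitely supported families of scalars
   indexed by [I], that is, the direct sum of copies of [R] over [I]. *)
Definition lincomb e c : V := \sum_(i <- msupp c) c@_i *: e i.

Definition is_basis e : Prop :=
  (forall v, exists c, v = lincomb e c) /\
  (forall c, lincomb e c = 0 -> c = 0).

Lemma is_basis_span e v : is_basis e -> exists c, v == lincomb e c.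
Proof. by case=> /(_ v) [c ->] _; exists c. Qed.

Definition coord e (be : is_basis e) v : {malg R[I]} :=
  xchoose (is_basis_span v be).

Lemma lincombEw e c (D : {fset I}) :
  msupp c `<=` D -> lincomb e c = \sum_(i <- D) c@_i *: e i.
Proof.
move=> sD; rewrite /lincomb (big_fset_incl _ sD) // => i _ ic.
by rewrite mcoeff_outdom // scale0r.
Qed.

Lemma lincomb_is_linear e : linear (lincomb e).
Proof.
move=> a c c'; pose D := msupp (a *: c + c') `|` (msupp c `|` msupp c').
rewrite !(@lincombEw e _ D) ?fsubsetUl //; last 2 first.
- by rewrite /D fsetUA fsubsetUr.
- by rewrite /D fsetUCA fsubsetUl.
rewrite scaler_sumr -big_split; apply: eq_bigr => i _ /=.
by rewrite mcoeffD mcoeffZ scalerDl scalerA.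
Qed.

HB.instance Definition _ e :=
  GRing.isLinear.Build R {malg R[I]} V _ (lincomb e) (lincomb_is_linear e).

Lemma lincombU e i : lincomb e << i >> = e i.
Proof. by rewrite /lincomb msuppU oner_eq0 big_seq_fset1 mcoeffUU scale1r. Qed.

Lemma lincomb_coord e (be : is_basis e) v : lincomb e (coord be v) = v.
Proof. exact/esym/eqP/(xchooseP (is_basis_span v be)). Qed.

Lemma coord_lincomb e (be : is_basis e) c : coord be (lincomb e c) = c.
Proof.
apply/eqP; rewrite -subr_eq0; apply/eqP.
by apply: be.2; rewrite linearB /= lincomb_coord subrr.
Qed.

End LinearCombinations.

Section Product.
Context {R : comNzRingType} {d : Order.disp_t} {M : orderType d}.
Implicit Types (q : M -> R) (H J : {fset M}).

Definition symdiff H J : {fset M} := (H `|` J) `\` (H `&` J).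

Definition alpha H J : R := \prod_(p <- H `*` J | (p.2 < p.1)%O) (-1).

Definition beta q H J : R := \prod_(i <- H `&` J) q i.

Definition sigma q H J : R := alpha H J * beta q H J.

Definition basisW H : {malg R[{fset M}]} := << H >>.

Definition mulW q (X Y : {malg R[{fset M}]}) : {malg R[{fset M}]} :=
  \sum_(H <- msupp X) \sum_(J <- msupp Y)
    (X@_H * Y@_J * sigma q H J) *: basisW (symdiff H J).

Lemma mulW_basis q H J :
  mulW q (basisW H) (basisW J) = sigma q H J *: basisW (symdiff H J).
Proof.
rewrite /mulW /basisW !msuppU !oner_eq0 !big_seq_fset1.
by rewrite !mcoeffUU !mul1r.
Qed.

End Product.

Section Inclusion.
Context {R : comNzRingType} {d : Order.disp_t} {M : orderType d}.
Context {V : lmodType R}.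
Implicit Types (e : M -> V) (x : V).

(* The identification of [V] with a submodule of the direct sum of copies of
   [R] over the finite subsets of [M]: the linear map that sends the basis
   vector [e i] to the basis vector attached to [[fset i]]. *)
Definition inclW e (be : is_basis e) x : {malg R[{fset M}]} :=
  lincomb (fun i => basisW [fset i]) (coord be x).

Lemma inclW_basis e (be : is_basis e) i : inclW be (e i) = basisW [fset i].
Proof. by rewrite /inclW -[e i]lincombU coord_lincomb lincombU. Qed.

Lemma inclW_linear e (be : is_basis e) : linear (inclW be).
Proof.
move=> a x y; rewrite /inclW -linearP; congr lincomb.
rewrite -{1}(lincomb_coord be x) -{1}(lincomb_coord be y) -linearP.
exact: coord_lincomb.
Qed.

Lemma inclW_inj e (be : is_basis e) : injective (inclW be).
Proof.
move=> x y exy; rewrite -(lincomb_coord be x) -(lincomb_coord be y).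
congr lincomb; apply/malgP => i.
have coefE z : (inclW be z)@_[fset i] = (coord be z)@_i.
  rewrite /inclW (lincombEw _ (fsubsetUr [fset i] _)) raddf_sum /=.
  rewrite (big_fsetD1 i) ?in_fsetU ?in_fset1 ?eqxx //= mcoeffZ mcoeffUU mulr1.
  rewrite big_seq big1 ?addr0 // => j; rewrite in_fsetD1 => /andP[ji _].
  rewrite mcoeffZ mcoeffU; case: eqP => [/fset1_inj ij|_]; last by rewrite mulr0.
  by rewrite ij eqxx in ji.
by rewrite -!coefE exy.
Qed.

End Inclusion.

Definition is_algebra (R : comNzRingType) (W : lmodType R)
    (mul : W -> W -> W) (one : W) : Prop :=
  [/\ forall y, linear (mul^~ y), forall x, linear (mul x),
      associative mul, left_id one mul & right_id one mul].

(* Main.v *)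
Require Import Defs.
From mathcomp Require Import all_boot all_order all_algebra.
From mathcomp Require Import ring.

(** The product is bilinear by construction, so every claim reduces to basis
    vectors.

    Associativity is then the cocycle identity
      [sigma H J * sigma (H + J) K = sigma J K * sigma H (J + K)],
    where [+] is the symmetric difference, which is associative.  The two
    factors of [sigma] satisfy it separately.  The sign [alpha] is a double
    product of square roots of 1, and a factor repeated in [H] and [J] cancels:
    hence [alpha] is multiplicative in each argument with respect to [+], and
    every bimultiplicative map is a cocycle ([alpha_cocycle]).  For [beta], both
    sides are the product of the [q i] over those [i] that lie in at least two
    of [H], [J], [K] ([beta_cocycle]).

    For the quadratic relation, anticommutation and [e_i^2 = q i] say that
    [xy + yx] and [(B x y + B y x) 1] agree on pairs of basis vectors, hence
    everywhere ([bilinear_polar]).  This makes the set of all [x] with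
    [x^2 = B x x 1] closed under linear combinations, even where 2 is not
    invertible; it contains the basis, so it is [V]. *)

Set Implicit Arguments.
Unset Strict Implicit.
Unset Printing Implicit Defensive.

Import Order.TTheory GRing.Theory.

Local Open Scope fset_scope.
Local Open Scope ring_scope.

(** * Linear combinations *)

Lemma linear_at0 (R : comNzRingType) (U V : lmodType R) (f : U -> V) :
  linear f -> f 0 = 0.
Proof.
by move=> lf; have := lf (-1) 0 0; rewrite scaler0 addr0 scaleN1r addNr.
Qed.

Section LinearExtension.
Context {R : comNzRingType} {I : choiceType}.

Lemma lincomb_ind (V : lmodType R) (e : I -> V) (P : V -> Prop) :
    P 0 -> (forall a u v, P u -> P v -> P (a *: u + v)) ->
    (forall i, P (e i)) ->
  forall c, P (lincomb e c).
Proof.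
move=> P0 PD Pe c; rewrite /lincomb; elim: (enum_fset _) => [|i s IHs].
  by rewrite big_nil.
by rewrite big_cons; apply: PD.
Qed.

Lemma lincomb_monomials (c : {malg R[I]}) : lincomb (fun i => << i >>) c = c.
Proof.
rewrite [RHS]monalgE; apply: eq_bigr => i _.
by apply/malgP => j; rewrite mcoeffZ !mcoeffU mulr_natr.
Qed.

(** Applied in each argument in turn, this reduces the algebra axioms to basis
    vectors. *)
Lemma malg_linear_ext (U : lmodType R) (f g : {malg R[I]} -> U) :
  linear f -> linear g -> (forall i, f << i >> = g << i >>) -> f =1 g.
Proof.
move=> lf lg efg X; rewrite -(lincomb_monomials X).
apply: (lincomb_ind (P := fun Y => f Y = g Y)) => //.
- by rewrite !linear_at0.
by move=> a u v fgu fgv; rewrite lf lg fgu fgv.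
Qed.

End LinearExtension.

(** * The cocycle identity *)

Section Cocycle.
Context {R : comNzRingType} {d : Order.disp_t} {M : orderType d}.
Implicit Types (q f : M -> R) (H J K D : {fset M}).

Lemma in_symdiff H J i : (i \in symdiff H J) = (i \in H) (+) (i \in J).
Proof.
by rewrite /symdiff in_fsetD in_fsetI in_fsetU; case: (i \in H);
  case: (i \in J).
Qed.

Lemma symdiffC H J : symdiff H J = symdiff J H.
Proof. by apply/fsetP => i; rewrite !in_symdiff addbC. Qed.

Lemma symdiffA H J K : symdiff H (symdiff J K) = symdiff (symdiff H J) K.
Proof. by apply/fsetP => i; rewrite !in_symdiff addbA. Qed.

Lemma symdiff0s H : symdiff fset0 H = H.
Proof. by apply/fsetP => i; rewrite in_symdiff in_fset0. Qed.

Lemma symdiffs0 H : symdiff H fset0 = H.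
Proof. by rewrite symdiffC symdiff0s. Qed.

Lemma symdiffss H : symdiff H H = fset0.
Proof. by apply/fsetP => i; rewrite in_symdiff addbb in_fset0. Qed.

(** Products over different finite sets become comparable factor by factor
    once they are all written over one common superset. *)
Lemma prod_widen f H D : H `<=` D ->
  \prod_(i <- H) f i = \prod_(i <- D) (if i \in H then f i else 1).
Proof.
move=> sHD; rewrite [LHS]big_seq [LHS]big_mkcond /=.
by rewrite (big_fset_incl _ sHD) // => i _ /negPf ->.
Qed.

(** An index in both [H] and [J] contributes a square, that is 1, on the right
    and nothing on the left. *)
Lemma prod_symdiff f H J : (forall i, f i * f i = 1) ->
  \prod_(i <- symdiff H J) f i = (\prod_(i <- H) f i) * \prod_(i <- J) f i.
Proof.
move=> ff; have sHJ : symdiff H J `<=` H `|` J by exact: fsubsetDl.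
rewrite (prod_widen _ sHJ) (prod_widen _ (fsubsetUl H J)).
rewrite (prod_widen _ (fsubsetUr H J)) -big_split; apply: eq_bigr => i _ /=.
by rewrite in_symdiff; case: (i \in H); case: (i \in J);
  rewrite /= ?ff ?mul1r ?mulr1.
Qed.

Definition inv_sign (i j : M) : R := if (j < i)%O then -1 else 1.

Lemma inv_sign_sqr i j : inv_sign i j * inv_sign i j = 1 :> R.
Proof. by rewrite /inv_sign; case: ifP; rewrite ?mulrNN mulr1. Qed.

Lemma alphaE H J : alpha H J = \prod_(i <- H) \prod_(j <- J) inv_sign i j :> R.
Proof.
rewrite /alpha big_mkcond /=.
by rewrite big_imfset2 // => -[i j] [i' j'] _ _ /= [-> ->].
Qed.

Lemma alphaE_exchange H J :
  alpha H J = \prod_(j <- J) \prod_(i <- H) inv_sign i j :> R.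
Proof. by rewrite alphaE exchange_big. Qed.

Lemma alpha_symdiffl H J K : alpha (symdiff H J) K = alpha H K * alpha J K :> R.
Proof.
rewrite !alphaE prod_symdiff // => i; rewrite -big_split /= big1 // => j _.
exact: inv_sign_sqr.
Qed.

Lemma alpha_symdiffr H J K : alpha H (symdiff J K) = alpha H J * alpha H K :> R.
Proof.
rewrite !alphaE_exchange prod_symdiff // => j; rewrite -big_split /= big1 //.
move=> i _.
exact: inv_sign_sqr.
Qed.

(** By bimultiplicativity both sides are
    [alpha H J * alpha H K * alpha J K]. *)
Lemma alpha_cocycle H J K :
  alpha H J * alpha (symdiff H J) K = alpha J K * alpha H (symdiff J K) :> R.
Proof. rewrite alpha_symdiffl alpha_symdiffr; ring. Qed.

(** Both sides collect [q i] exactly once for each [i] in at least two of [H],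
    [J] and [K]: on the left, an index in both [H] and [J] is not in their
    symmetric difference, so it is not counted again; similarly on the right. *)
Lemma beta_cocycle q H J K :
  beta q H J * beta q (symdiff H J) K = beta q J K * beta q H (symdiff J K).
Proof.
pose D := H `|` J `|` K.
have betaE H' J' : H' `&` J' `<=` D ->
    beta q H' J' = \prod_(i <- D) (if (i \in H') && (i \in J') then q i else 1).
  move=> /prod_widen; rewrite /beta => ->.
  by apply: eq_bigr => i _; rewrite in_fsetI.
have subl H' J' : H' `<=` D -> H' `&` J' `<=` D.
  by apply/fsubset_trans/fsubsetIl.
have subr H' J' : J' `<=` D -> H' `&` J' `<=` D.
  by apply/fsubset_trans/fsubsetIr.
have sHD : H `<=` D by rewrite /D -fsetUA fsubsetUl.
have sJD : J `<=` D by rewrite /D fsetUAC fsubsetUr.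
have sKD : K `<=` D by exact: fsubsetUr.
rewrite (betaE H J) ?subl // (betaE _ K) ?subr // (betaE J K) ?subr //.
rewrite (betaE H _) ?subl //.
rewrite -!big_split; apply: eq_bigr => i _ /=; rewrite !in_symdiff.
case: (i \in H); case: (i \in J); case: (i \in K) => //=.
all: by rewrite ?mul1r ?mulr1.
Qed.

Lemma sigma_cocycle q H J K :
  sigma q H J * sigma q (symdiff H J) K = sigma q J K * sigma q H (symdiff J K).
Proof. by rewrite /sigma mulrACA alpha_cocycle beta_cocycle mulrACA. Qed.

Lemma sigma0s q H : sigma q fset0 H = 1.
Proof. by rewrite /sigma alphaE /beta fset0I !big_seq_fset0 mulr1. Qed.

Lemma sigmas0 q H : sigma q H fset0 = 1.
Proof. by rewrite /sigma alphaE_exchange /beta fsetI0 !big_seq_fset0 mulr1. Qed.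

Lemma alpha1 i j : alpha [fset i] [fset j] = inv_sign i j :> R.
Proof. by rewrite alphaE !big_seq_fset1. Qed.

Lemma sigma1_diag q i : sigma q [fset i] [fset i] = q i.
Proof.
by rewrite /sigma alpha1 /inv_sign ltxx mul1r /beta fsetIid big_seq_fset1.
Qed.

Lemma sigma1_anti q i j : i != j ->
  sigma q [fset i] [fset j] = - sigma q [fset j] [fset i].
Proof.
move=> ij; rewrite /sigma !alpha1 /beta.
have /eqP I0 : [fset i] `&` [fset j] == fset0.
  by rewrite fsetI_eq0 fdisjoint1X in_fset1.
rewrite (fsetIC [fset j]) I0 big_seq_fset0 !mulr1 /inv_sign.
by case: (ltgtP i j) ij => // _ _; rewrite opprK.
Qed.

End Cocycle.

(** * The algebra *)

Section Algebra.
Context {R : comNzRingType} {d : Order.disp_t} {M : orderType d}.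
Variable q : M -> R.
Implicit Types (X Y Z : {malg R[{fset M}]}).

(** Linearity of [lincomb] in its coefficients turns this form into bilinearity,
    with no bookkeeping of supports. *)
Lemma mulWE X Y :
  mulW q X Y =
  lincomb (fun H => lincomb (fun J => sigma q H J *: basisW (symdiff H J)) Y) X.
Proof.
apply: eq_bigr => H _; rewrite scaler_sumr; apply: eq_bigr => J _.
by rewrite !scalerA.
Qed.

Lemma mulW_linearl Y : linear (mulW q ^~ Y).
Proof. by move=> a X X'; rewrite /= !mulWE linearP. Qed.

Lemma mulW_linearr X : linear (mulW q X).
Proof.
move=> a Y Y'; rewrite !mulWE /lincomb scaler_sumr -big_split /=.
apply: eq_bigr => H _; rewrite -!/(lincomb _ _) linearP scalerDr !scalerA.
by rewrite [_ * a]mulrC.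
Qed.

Lemma mulWZl a X Y : mulW q (a *: X) Y = a *: mulW q X Y.
Proof. by rewrite !mulWE linearZ. Qed.

Lemma mulWZr a X Y : mulW q X (a *: Y) = a *: mulW q X Y.
Proof.
by rewrite -[a *: Y]addr0 mulW_linearr (linear_at0 (mulW_linearr X)) addr0.
Qed.

Lemma mulWA : associative (mulW q).
Proof.
move=> X Y Z; move: X.
apply: malg_linear_ext => [a X X'|a X X'|H].
- exact: mulW_linearl.
- by rewrite !mulW_linearl.
move: Y; apply: malg_linear_ext => [a Y Y'|a Y Y'|J].
- by rewrite mulW_linearl mulW_linearr.
- by rewrite mulW_linearr mulW_linearl.
move: Z; apply: malg_linear_ext => [a Z Z'|a Z Z'|K].
- by rewrite !mulW_linearr.
- exact: mulW_linearr.
rewrite -!/(basisW _) !mulW_basis mulWZl mulWZr !mulW_basis !scalerA.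
by rewrite symdiffA sigma_cocycle.
Qed.

Lemma mul1W : left_id (basisW fset0) (mulW q).
Proof.
apply: malg_linear_ext => [a X X'|a X X'|H] //; first exact: mulW_linearr.
by rewrite -/(basisW _) mulW_basis sigma0s scale1r symdiff0s.
Qed.

Lemma mulW1 : right_id (basisW fset0) (mulW q).
Proof.
apply: malg_linear_ext => [a X X'|a X X'|H] //; first exact: mulW_linearl.
by rewrite -/(basisW _) mulW_basis sigmas0 scale1r symdiffs0.
Qed.

Lemma mulW_is_algebra : is_algebra (mulW q) (basisW fset0).
Proof.
split; [exact: mulW_linearl | exact: mulW_linearr | exact: mulWA |
        exact: mul1W | exact: mulW1].
Qed.

Lemma mulW_basis_anti i j : i != j ->
  mulW q (basisW [fset i]) (basisW [fset j])
  = - mulW q (basisW [fset j]) (basisW [fset i]).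
Proof. by move=> ij; rewrite !mulW_basis sigma1_anti // symdiffC scaleNr. Qed.

Lemma mulW_basis_sqr i :
  mulW q (basisW [fset i]) (basisW [fset i]) = q i *: basisW fset0.
Proof. by rewrite mulW_basis sigma1_diag symdiffss. Qed.

End Algebra.

(** * The quadratic relation *)

(** Only bilinearity and the relations between basis vectors matter here, so
    the product is an arbitrary bilinear map [m] with a distinguished value
    [one]. *)
Section Quadratic.
Context {R : comNzRingType} {V U : lmodType R} {I : choiceType}.
Context {e : I -> V} (B : {biscalar V}) (m : V -> V -> U) (one : U).
Hypothesis e_basis : is_basis e.
Hypothesis B_diag : forall i j, i != j -> B (e i) (e j) = 0.
Hypothesis m_linearl : forall y, linear (m ^~ y).
Hypothesis m_linearr : forall x, linear (m x).
Hypothesis m_sqr : forall i, m (e i) (e i) = B (e i) (e i) *: one.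
Hypothesis m_anti : forall i j, i != j -> m (e i) (e j) = - m (e j) (e i).

Lemma basis_ind (P : V -> Prop) :
    P 0 -> (forall a u v, P u -> P v -> P (a *: u + v)) ->
    (forall i, P (e i)) ->
  forall x, P x.
Proof.
by move=> P0 PD Pe x; rewrite -(lincomb_coord e_basis x); apply: lincomb_ind.
Qed.

(** Unlike [m x x = B x x *: one], this identity is bilinear in [(x, y)], so it
    only has to be checked on pairs of basis vectors.  Being symmetric in [x]
    and [y], it is extended from the basis by the same argument in each. *)
Lemma bilinear_polar x y : m x y + m y x = (B x y + B y x) *: one.
Proof.
have step z :
    (forall i, m z (e i) + m (e i) z = (B z (e i) + B (e i) z) *: one) ->
  forall u, m z u + m u z = (B z u + B u z) *: one.
  pose P u := m z u + m u z = (B z u + B u z) *: one.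
  move=> He; apply: (basis_ind (P := P)) => [|a u v|//]; rewrite /P.
    rewrite (linear_at0 (m_linearl z)) (linear_at0 (m_linearr z)).
    by rewrite linear0l linear0r !addr0 scale0r.
  move=> IHu IHv; rewrite m_linearl m_linearr linearPl linearPr /= addrACA.
  rewrite -scalerDr IHu IHv scalerA -scalerDl.
  by congr (_ *: _); ring.
apply: (step) => i; rewrite addrC [B x _ + _]addrC; apply: (step) => j.
have [<-|ij] := eqVneq i j; first by rewrite m_sqr -scalerDl.
have ji : j != i by rewrite eq_sym.
by rewrite m_anti // addNr (B_diag ij) (B_diag ji) addr0 scale0r.
Qed.

(** The square of [a *: u + v] differs from [a ^+ 2] times that of [u] plus that
    of [v] by the cross terms [a *: (m u v + m v u)], which [bilinear_polar]
    evaluates. *)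
Lemma bilinear_sqr x : m x x = B x x *: one.
Proof.
pose P u := m u u = B u u *: one.
apply: (basis_ind (P := P)) => [|a u v|//]; rewrite /P.
  by rewrite (linear_at0 (m_linearr 0)) linear0l scale0r.
move=> IHu IHv; rewrite m_linearl !m_linearr linearPl !linearPr /= IHu IHv.
rewrite scalerDr -addrA [a *: m u v + _]addrA -scalerDr bilinear_polar.
rewrite !scalerA -!scalerDl.
by congr (_ *: _); ring.
Qed.

End Quadratic.

Theorem theorem1 (R : comNzRingType) (V : lmodType R)
    (d : Order.disp_t) (M : orderType d) (e : M -> V) (B : {biscalar V})
    (V_neq0 : exists v : V, v != 0)
    (e_basis : is_basis e)
    (B_diag : forall i j : M, i != j -> B (e i) (e j) = 0) :
  let q := fun i : M => B (e i) (e i) in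
  [/\ is_algebra (mulW q) (basisW fset0),
      forall i j : M, i != j ->
        mulW q (inclW e_basis (e i)) (inclW e_basis (e j))
        = - mulW q (inclW e_basis (e j)) (inclW e_basis (e i))
    & forall x : V,
        mulW q (inclW e_basis x) (inclW e_basis x) = B x x *: basisW fset0].
Proof.
move=> q; split; first exact: mulW_is_algebra.
  by move=> i j ij; rewrite !inclW_basis mulW_basis_anti.
pose m x y := mulW q (inclW e_basis x) (inclW e_basis y).
apply: (bilinear_sqr (m := m) e_basis B_diag); rewrite /m.
- by move=> y a x x'; rewrite /= inclW_linear mulW_linearl.
- by move=> x a y y'; rewrite inclW_linear mulW_linearr.
- by move=> i; rewrite inclW_basis mulW_basis_sqr.
- by move=> i j ij; rewrite !inclW_basis mulW_basis_anti.
Qed.
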